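(* Let $\lambda$ and $\mu$ be partitions. Suppose $\tau^l(\lambda)=(\boldsymbol{\lambda}^l,\mathbf{s}^l)$, $\tau_e(\lambda)=(\boldsymbol{\lambda}_e,\mathbf{s}_e)$, $\tau^l(\mu)=(\boldsymbol{\mu}^l,\mathbf{s}^l)$ and $\tau_e(\mu)=(\boldsymbol{\mu}_e,\mathbf{s}_e)$ (so that $\lambda$ and $\mu$ have the same associated $l$-multicharge $\mathbf{s}^l$ and the same associated $e$-multicharge $\mathbf{s}_e$). If $|\boldsymbol{\mu}^l|=|\boldsymbol{\lambda}^l|$, then $|\boldsymbol{\mu}_e|=|\boldsymbol{\lambda}_e|$.
   Context: Fix integers $e\ge 2$, $l\ge 1$ and $m\in\mathbb{Z}$. For $r\ge1$, an $r$-partition is an $r$-tuple of partitions; its size $|\cdot|$ is the sum of the sizes of its components. $\Pi^r$ is the set of $r$-partitions and $\Pi=\Pi^1$. $\mathbb{Z}^r[m]$ is the set of $(s_0,\dots,s_{r-1})\in\mathbb{Z}^r$ with $\sum_{i=0}^{r-1}s_i=m$. A symbol of charge $m$ is a strictly increasing sequence of integers $X=(\beta_i)_{i<m}$ with $\beta_j=j$ for all sufficiently negative $j$; it is identified with the set of its entries. To a partition $\lambda=(\lambda_1\ge\lambda_2\ge\cdots)$ (with $\lambda_k=0$ for large $k$) one attaches the symbol $X^m(\lambda)=\{\lambda_j-j+m : j\ge 1\}$ of charge $m$; this is a bijection between partitions and symbols of charge $m$. An $r$-symbol is an $r$-tuple of symbols, and its multicharge is the tuple of their charges. To $\boldsymbol{\lambda}=(\lambda^0,\dots,\lambda^{r-1})\in\Pi^r$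 and $\mathbf{s}=(s_0,\dots,s_{r-1})\in\mathbb{Z}^r$ one attaches the $r$-symbol $(X^{s_0}(\lambda^0),\dots,X^{s_{r-1}}(\lambda^{r-1}))$; this is a bijection from pairs $(\boldsymbol{\lambda},\mathbf{s})$ to $r$-symbols. Map $\tau_e$ (with $m$ fixed): for a partition $\lambda$ and $0\le j\le e-1$ put $Y^j=\{k\in\mathbb{Z} : j+ke\in X^m(\lambda)\}$. Then $(Y^0,\dots,Y^{e-1})$ is the $e$-symbol of a unique pair $(\boldsymbol{\lambda}_e,\mathbf{s}_e)\in\Pi^e\times\mathbb{Z}^e[m]$, and $\tau_e(\lambda):=(\boldsymbol{\lambda}_e,\mathbf{s}_e)$. Map $\tau^l$ (with $m$ and $e$ fixed): write each $\beta\in X^m(\lambda)$ uniquely as $\beta=c+ed+elq$ with $0\le c\le e-1$, $0\le d\le l-1$, $q\in\mathbb{Z}$. For $0\le d\le l-1$ let $X_d$ be the set of all $c+eq$ coming from those $\beta$ with this value of $d$. Then $(X_{l-1},X_{l-2},\dots,X_0)$ (its component of index $k$ is $X_{l-1-k}$, $0\le k\le l-1$) is the $l$-symbol of a unique pair $(\boldsymbol{\lambda}^l,\mathbf{s}^l)\in\Pi^l\times\mathbb{Z}^l[m]$, and $\tau^l(\lambda):=(\boldsymbol{\lambda}^l,\mathbf{s}^l)$. *)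

(* Defs.v *)
From HB Require Import structures.
From mathcomp Require Import all_boot all_order all_algebra.
From mathcomp Require Import boolp classical_sets.
From mathcomp Require Import zify ring lra.

Set Implicit Arguments.
Unset Strict Implicit.
Unset Printing Implicit Defensive.

Import Order.TTheory GRing.Theory Num.Theory.

Local Open Scope classical_set_scope.
Local Open Scope ring_scope.

(** * Partitions and multipartitions *)

Definition is_intpart (s : seq nat) : bool := sorted geq s && (0%N \notin s).

Record intpart := IntPart {ip_val :> seq nat; _ : is_intpart ip_val}.
HB.instance Definition _ := [isSub for ip_val].
HB.instance Definition _ := [Choice of intpart by <:].

Definition part_size (la : intpart) : nat := sumn la.

Lemma is_intpart_nil : is_intpart [::]. Proof. by []. Qed.
Definition part0 : intpart := IntPart is_intpart_nil.

Definition multipartition (r : nat) := {ffun 'I_r -> intpart}.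
Definition mpart_size r (la : multipartition r) : nat :=
  (\sum_(i < r) part_size (la i))%N.

Definition multicharge (r : nat) := {ffun 'I_r -> int}.
Definition multicharges_of_sum r (m : int) : set (multicharge r) :=
  [set s | \sum_(i < r) s i = m].

(** * Symbols *)

(** Parts are numbered from 0 by [nth 0 la], which is the part of index
    [j.+1] in the usual numbering; hence the shift in the formula. *)
Definition symbol (m : int) (la : intpart) : set int :=
  [set x | exists j : nat, x = (nth 0%N la j)%:Z - (j.+1)%:Z + m].

Definition rsymbol r (p : multipartition r * multicharge r) : 'I_r -> set int :=
  fun i => symbol (p.2 i) (p.1 i).

(** The pair of charge sum [m] whose [r]-symbol is [Y], with a default value
    if there is none; see [tau_eP] and [tau_lP] for the existence and the
    uniqueness in the cases of interest. *)
Definition pair_of_rsymbol r (m : int) (Y : 'I_r -> set int) :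
    multipartition r * multicharge r :=
  xget ([ffun=> part0], [ffun=> 0])
    [set p | multicharges_of_sum m p.2 /\ rsymbol p = Y].

(** * The maps [tau_e] and [tau^l] *)

Definition e_components (m : int) (e : nat) (la : intpart) : 'I_e -> set int :=
  fun j => [set k | symbol m la (j%:Z + k * e%:Z)].

Definition tau_e (m : int) (e : nat) (la : intpart) :
    multipartition e * multicharge e :=
  pair_of_rsymbol m (e_components m la).

Definition l_components (m : int) (e l : nat) (la : intpart) :
    'I_l -> set int :=
  fun d => [set x | exists (c : 'I_e) (q : int), x = c%:Z + e%:Z * q /\
                    symbol m la (c%:Z + e%:Z * d%:Z + e%:Z * l%:Z * q)].

(** [rev_ord k] has value [l - 1 - k]. *)
Definition tau_l (m : int) (e l : nat) (la : intpart) :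
    multipartition l * multicharge l :=
  pair_of_rsymbol m (fun k => l_components m e la (rev_ord k)).

(** * Existence and uniqueness in the definitions of [tau_e] and [tau_l] *)

Lemma nth_part_le (la : intpart) i j : (i <= j)%N ->
  (nth 0 la j <= nth 0 la i)%N.
Proof.
case: la => s /= /andP[so _] ij.
have [js|js] := ltnP j (size s); last by rewrite nth_default.
have tr : transitive geq by move=> x y z /= yx xz; exact: leq_trans xz yx.
by apply: (sorted_leq_nth tr (fun x => leqnn x) 0%N so) => //; rewrite inE; lia.
Qed.

Lemma part_eq_nth (la mu : intpart) :
  (forall j, nth 0%N la j = nth 0%N mu j) -> la = mu.
Proof.
case: la mu => s hs [t ht] /= H; apply: val_inj => /=.
have pos (u : seq nat) j : is_intpart u -> (j < size u)%N -> nth 0%N u j <> 0%N.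
  by case/andP=> _ z ju E; move/negP: z; apply; rewrite -E mem_nth.
apply: (@eq_from_nth _ 0%N) => //.
apply/eqP; rewrite eqn_leq; apply/andP; split; rewrite leqNgt; apply/negP => k.
  by apply: (pos _ _ hs k); rewrite H nth_default.
by apply: (pos _ _ ht k); rewrite -H nth_default.
Qed.

Lemma symbol_inj (s t : int) (la mu : intpart) :
  symbol s la = symbol t mu -> s = t /\ la = mu.
Proof.
pose b (s : int) (la : intpart) (j : nat) : int :=
  (nth 0%N la j)%:Z - (j.+1)%:Z + s.
have bdec u nu i j : (i < j)%N -> b u nu j < b u nu i.
  by move=> ij; rewrite /b; have := @nth_part_le nu i j (ltnW ij); lia.
have le u v nu rho j : symbol u nu = symbol v rho ->
    (forall i, (i < j)%N -> b u nu i = b v rho i) -> b u nu j <= b v rho j.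
  move=> E IH.
  have : symbol u nu (b u nu j) by exists j.
  rewrite E => -[i]; rewrite -/(b v rho i) => bi.
  have [ij|] := ltnP i j.
    by have := bdec u nu i j ij; rewrite (IH _ ij) bi ltxx.
  rewrite bi leq_eqVlt => /orP[/eqP <- //|ji].
  by apply: ltW; exact: (bdec v rho).
move=> E.
have H j : b s la j = b t mu j.
  elim/ltn_ind: j => j IH; apply: le_anti; apply/andP; split; first exact: le.
  by apply: le => // i ij; rewrite IH.
have st : s = t.
  have := H (maxn (size la) (size mu)).
  by rewrite /b !nth_default ?leq_maxl ?leq_maxr //; lia.
split=> //; apply: part_eq_nth => j.
by have := H j; rewrite /b st; lia.
Qed.

Definition count_above (X : set int) (N : int) (K : nat) : nat :=
  (\sum_(0 <= i < K) `[< X (N + i%:Z)%R >])%N.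

Lemma count_above_le X N K : (count_above X N K <= K)%N.
Proof.
rewrite /count_above; elim: K => [|K IH]; first by rewrite big_geq.
by rewrite big_nat_recr //=; case: asboolP => _; lia.
Qed.

Lemma ex_partition (X : set int) (N : int) (K : nat) :
  (forall x : int, x < N -> X x) -> (forall x : int, N + K%:Z <= x -> ~ X x) ->
  exists la, symbol (N + (count_above X N K)%:Z) la = X.
Proof.
elim: K X => [|K IH] X lo hi.
  exists part0; rewrite /count_above big_geq // addr0.
  apply/seteqP; split=> x /=.
    by case=> j; rewrite nth_nil => ->; apply: lo; lia.
  move=> Xx; have xN : x < N.
    by rewrite ltNge; apply/negP => Nx; apply: (hi x) Xx; lia.
  by exists (absz (N - x - 1)%R); rewrite nth_nil; lia.
rewrite /count_above big_nat_recr //= -/(count_above X N K).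
case: asboolP => XK; last first.
  rewrite addn0; apply: IH => // x xN Xx.
  have [E|] := eqVneq x (N + K%:Z); first by apply: XK; rewrite -E.
  by move=> ne; apply: (hi x) => //; lia.
pose X' := X `\ (N + K%:Z).
have lo' x : x < N -> X' x by move=> xN; split; [exact: lo | move=> /= E; lia].
have hi' x : N + K%:Z <= x -> ~ X' x.
  by move=> xN [Xx /= ne]; apply: (hi x) => //; move/eqP: ne; lia.
have [la E] := IH X' lo' hi'.
have CE : count_above X' N K = count_above X N K.
  apply: eq_big_nat => i ik; congr nat_of_bool.
  apply: asbool_equiv_eq; split; first by case.
  by move=> Xi; split => //= ; lia.
rewrite CE in E.
have cK := count_above_le X N K.
set c := count_above X N K in E cK *.
have la0 : (nth 0 la 0 <= K - c)%N.
  have : X' ((nth 0%N la 0)%:Z - 1 + (N + c%:Z)) by rewrite -E; exists 0%N.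
  move=> h; have : ~ (N + K%:Z <= (nth 0%N la 0)%:Z - 1 + (N + c%:Z)).
    by move/hi'; apply.
  lia.
have [mu hmu] : exists mu : intpart, forall j,
    nth 0%N mu j = if j is i.+1 then nth 0%N la i else (K - c)%N.
  have [Kc0|Kc] := posnP (K - c)%N.
    exists part0 => -[|j]; rewrite nth_nil ?Kc0 //.
    by have := @nth_part_le la 0 j isT; lia.
  have p : is_intpart ((K - c)%N :: la).
    case: la la0 {E} => -[|a s] /andP[so z] /= la0; apply/andP; split => //=.
    - by rewrite inE; lia.
    - by rewrite la0.
    - by rewrite inE negb_or z andbT; lia.
  by exists (IntPart p) => -[|j].
exists mu; apply/seteqP; split=> x /=.
  case=> -[|j]; rewrite hmu => ->.
    by suff -> : (K - c)%:Z - 1%:Z + (N + (c + 1)%:Z) = N + K%:Z by []; lia.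
  have [] // : X' ((nth 0%N la j)%:Z - (j.+2)%:Z + (N + (c + 1)%:Z)).
  by rewrite -E; exists j; lia.
move=> Xx; have [->|ne] := eqVneq x (N + K%:Z).
  by exists 0%N; rewrite hmu; lia.
have : X' x by split=> //= /eqP; rewrite (negbTE ne).
by rewrite -E => -[j ->]; exists j.+1; rewrite hmu; lia.
Qed.

Lemma symbol_bounds (m : int) (la : intpart) : exists K0 : nat,
  forall K, (K0 <= K)%N ->
  [/\ forall x : int, x < - K%:Z -> symbol m la x,
      forall x : int, K%:Z <= x -> ~ symbol m la x &
      m = - K%:Z + (count_above (symbol m la) (- K%:Z) (K + K))%:Z].
Proof.
exists (absz m + size la + nth 0%N la 0)%N => K hK.
have lo x : x < - K%:Z -> symbol m la x.
  by exists (absz (m - x - 1)%R); rewrite nth_default; lia.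
have hi x : K%:Z <= x -> ~ symbol m la x.
  by move=> Kx [j]; have := @nth_part_le la 0 j isT; lia.
split=> //.
have [|mu E] := @ex_partition (symbol m la) (- K%:Z) (K + K) lo.
  by move=> x xK; apply: hi; lia.
by have [->] := symbol_inj E.
Qed.

Lemma pair_of_rsymbolP r (m : int) (Y : 'I_r -> set int) (N : int) (K : nat) p :
  (forall i (x : int), x < N -> Y i x) ->
  (forall i (x : int), N + K%:Z <= x -> ~ Y i x) ->
  \sum_(i < r) (N + (count_above (Y i) N K)%:Z) = m ->
  pair_of_rsymbol m Y = p <-> multicharges_of_sum m p.2 /\ rsymbol p = Y.
Proof.
move=> lo hi sm.
pose P := [set p : multipartition r * multicharge r |
             multicharges_of_sum m p.2 /\ rsymbol p = Y].
have [q Pq] : exists q, P q.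
  have ex i : exists la, symbol (N + (count_above (Y i) N K)%:Z) la = Y i.
    by apply: ex_partition; [exact: lo | exact: hi].
  have /choice[f hf] := ex.
  exists ([ffun i => f i], [ffun i => N + (count_above (Y i) N K)%:Z]); split.
    by rewrite /multicharges_of_sum /= -[RHS]sm; apply: eq_bigr => i _; rewrite ffunE.
  by apply/funext => i; rewrite /rsymbol /= !ffunE.
have uniq u v : P u -> P v -> u = v.
  case: u v => [a s] [b t] [_ /= Ea] [_ /= Eb].
  have H i : s i = t i /\ a i = b i.
    by apply: symbol_inj; have := congr1 (@^~ i) (etrans Ea (esym Eb)).
  by congr pair; apply/ffunP => i; have [] := H i.
have PX : P (pair_of_rsymbol m Y) by apply: xgetPex; exists q.
by split=> [<- //|Pp]; exact: uniq.
Qed.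

Lemma sum_nat_mul (F : nat -> nat) (n k : nat) :
  (\sum_(0 <= i < n * k) F i = \sum_(0 <= q < n) \sum_(0 <= j < k) F (q * k + j))%N.
Proof.
rewrite big_nat_mul; apply: eq_bigr => q _.
rewrite -{1}[(q * k)%N]add0n big_addn mulSn addnK.
by apply: eq_bigr => j _; rewrite addnC.
Qed.

Lemma tau_eP (m : int) (e : nat) (la : intpart) p : (0 < e)%N ->
  tau_e m e la = p <->
  multicharges_of_sum m p.2 /\ rsymbol p = e_components m la.
Proof.
move=> e0; have [K0 hK0] := symbol_bounds m la.
have [lo hi mE] := hK0 (K0.+1 * e)%N ltac:(nia).
apply: (@pair_of_rsymbolP _ _ _ (- K0.+1%:Z) (K0.+1 + K0.+1)).
- by move=> i x xN; apply: lo; have := ltn_ord i; nia.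
- by move=> i x xN; apply: hi; have := ltn_ord i; nia.
rewrite big_split /= sumr_const card_ord [RHS]mE; congr (_ + _).
  by rewrite mulNrn; nia.
rewrite -mulnDl -(big_morph Posz PoszD (erefl _)); congr Posz.
rewrite /count_above sum_nat_mul exchange_big /=.
apply: eq_bigr => q _; rewrite [RHS]big_mkord; apply: eq_bigr => i _.
by rewrite /e_components /=; congr (nat_of_bool `[< symbol _ _ _ >]); nia.
Qed.

Lemma l_componentsE (m : int) (e l : nat) (la : intpart) (d : 'I_l) (c : nat)
    (q : int) : (c < e)%N ->
  l_components m e la d (c%:Z + e%:Z * q) <->
  symbol m la (c%:Z + e%:Z * d%:Z + e%:Z * l%:Z * q).
Proof.
move=> ce; split=> [|h]; last by exists (Ordinal ce), q.
case=> c' [q' [E]]; have c'e := ltn_ord c'.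
have qq : q = q'.
  have [lt|lt|//] := ltgtP q q'.
    have := ler_wpM2r (ler0n int e) (_ : q + 1 <= q'); rewrite lezD1 => /(_ lt).
    by lia.
  have := ler_wpM2r (ler0n int e) (_ : q' + 1 <= q); rewrite lezD1 => /(_ lt).
  by lia.
rewrite -{}qq in E *.
by have -> : c'%:Z = c%:Z by lia.
Qed.

Lemma tau_lP (m : int) (e l : nat) (la : intpart) p : (0 < e)%N -> (0 < l)%N ->
  tau_l m e l la = p <->
  multicharges_of_sum m p.2 /\
  rsymbol p = fun k => l_components m e la (rev_ord k).
Proof.
move=> e0 l0; have [K0 hK0] := symbol_bounds m la.
have [lo hi mE] := hK0 (K0.+1 * l * e)%N ltac:(nia).
have decomp (x : int) : exists (c : nat) (q : int),
    (c < e)%N /\ x = c%:Z + e%:Z * q.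
  exists (absz (x %% e%:Z)%Z), (x %/ e%:Z)%Z.
  have := divz_eq x e%:Z; have := modz_ge0 x (_ : e%:Z != 0).
  have := ltz_pmod x (_ : 0 < e%:Z).
  move=> /(_ e0) h1 /(_ ltac:(lia)) h2 h3; split; lia.
apply: (@pair_of_rsymbolP _ _ _ (- (K0.+1 * e)%:Z)
          ((K0.+1 + K0.+1) * e)).
- move=> i x xN; have [c [q [ce xE]]] := decomp x; rewrite xE.
  apply/l_componentsE => //; apply: lo.
  have := ltn_ord (rev_ord i); move: (nat_of_ord _) => d dl.
  have q1 : q <= - (K0.+2)%:Z by nia.
  have : e%:Z * l%:Z * q <= e%:Z * l%:Z * (- (K0.+2)%:Z) by rewrite ler_wpM2l.
  have : e%:Z * d%:Z + e%:Z <= e%:Z * l%:Z by nia.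
  by nia.
- move=> i x xN; have [c [q [ce xE]]] := decomp x; rewrite xE.
  move/l_componentsE => /(_ ce); apply: hi.
  have q1 : (K0.+1)%:Z <= q by nia.
  have : e%:Z * l%:Z * (K0.+1)%:Z <= e%:Z * l%:Z * q by rewrite ler_wpM2l.
  by nia.
rewrite big_split /= sumr_const card_ord [RHS]mE; congr (_ + _).
  by rewrite mulNrn; nia.
rewrite -!mulnDl -(big_morph Posz PoszD (erefl _)); congr Posz.
rewrite /count_above sum_nat_mul sum_nat_mul.
rewrite (reindex_inj rev_ord_inj) /=.
under eq_bigr do rewrite sum_nat_mul rev_ordK.
rewrite exchange_big /=; apply: eq_bigr => q _.
rewrite [RHS]big_mkord; apply: eq_bigr => d _.
apply: eq_big_nat => j /andP[_ je]; congr nat_of_bool.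
apply: asbool_equiv_eq.
have -> : - (K0.+1 * e)%:Z + (q * e + j)%:Z = j%:Z + e%:Z * (q%:Z - K0.+1%:Z) by nia.
rewrite l_componentsE //.
suff -> : j%:Z + e%:Z * d%:Z + e%:Z * l%:Z * (q%:Z - K0.+1%:Z)
  = - (K0.+1 * l * e)%:Z + ((q * l + d) * e + j)%:Z by [].
by nia.
Qed.

(* Main.v *)
Require Import Defs.
From mathcomp Require Import all_boot all_order all_algebra.
From mathcomp Require Import boolp classical_sets.
From mathcomp Require Import zify ring.

Set Implicit Arguments.
Unset Strict Implicit.
Unset Printing Implicit Defensive.

Import Order.TTheory GRing.Theory Num.Theory.

Local Open Scope classical_set_scope.
Local Open Scope ring_scope.

(** Write each entry of the symbol of [la] as [c + e d + e l q] with [c < e] and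
    [d < l]. Such an entry contributes [d + l q] to the component [c] of the
    [e]-symbol and [c + e q] to the component [l - 1 - d] of the [l]-symbol. Up
    to a constant given by the charge, the size of a partition is the sum of the
    entries of its symbol. Since [e (d + l q) - l (c + e q) = e d - l c], the
    number [e |la_e| - l |la^l|] is therefore, up to charges, the sum of
    [e d - l c] over the entries of the symbol of [la]. But the sum of the [c]
    only depends on how many entries there are in each component of the
    [e]-symbol, that is on the charges [s_e], and likewise the sum of the [d] is
    given by [s^l]. So [e |la_e| - l |la^l|] is a function of the two
    multicharges ([size_balance]), and the theorem follows since [e] is nonzero.

    These sums are infinite, so they are truncated to the entries in a window
    [[-K, K)], outside of which every symbol considered agrees with the negative
    integers. The windows [[-Ml, Ml)] for the [e]-symbol and [[-Me, Me)] for the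
    [l]-symbol see the same entries of the symbol of [la], namely those with
    [-M <= q < M]; this is what allows the two truncated sums to be compared. *)

Definition ind (X : set int) (x : int) : int := nat_of_bool `[< X x >].

Definition moment (X : set int) (K : nat) : int :=
  \sum_(0 <= i < K + K) ind X (- K%:Z + i%:Z) * (- K%:Z + i%:Z).

(** The part of the sum of the entries, in the window, of a symbol of charge [s]
    that does not involve the parts: the value for the empty partition. *)
Definition vacuum_moment (s : int) (K : nat) : int :=
  \sum_(0 <= j < absz (s + K%:Z)%R) (s - j.+1%:Z).

Lemma count_aboveE X N K :
  (count_above X N K)%:Z = \sum_(0 <= i < K) ind X (N + i%:Z).
Proof. by rewrite /count_above (big_morph Posz PoszD (erefl _)). Qed.

Lemma part_sizeE (la : intpart) n : (size la <= n)%N ->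
  (part_size la)%:Z = \sum_(0 <= j < n) (nth 0%N la j)%:Z.
Proof.
move=> sn; rewrite /part_size sumnE (big_nth 0%N).
rewrite (big_morph Posz PoszD (erefl _)) (big_cat_nat _ sn) //=.
rewrite [X in _ + X]big_nat_cond [X in _ + X]big1 ?addr0 //.
by move=> i /andP[/andP[si _] _]; rewrite nth_default.
Qed.

(** Size and charge as truncated sums. The window contains exactly the first
    [s + K] entries of the symbol: the [j]-th entry is at least [s - j - 1],
    hence in the window for [j < s + K], and the count of entries in the window
    leaves no room for any other. When [K] is large these entries involve all
    the nonzero parts. *)
Lemma symbol_moment (s : int) (la : intpart) :
  exists K0, forall K, (K0 <= K)%N ->
  s + K%:Z = \sum_(0 <= i < K + K) ind (symbol s la) (- K%:Z + i%:Z) /\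
  moment (symbol s la) K = (part_size la)%:Z + vacuum_moment s K.
Proof.
have [K1 hK1] := symbol_bounds s la.
exists (K1 + absz s + size la)%N => K hK.
have [_ hi sE] := hK1 K ltac:(lia).
set X := symbol s la in hi sE *.
rewrite -count_aboveE; split; first lia.
rewrite /vacuum_moment.
have -> : absz (s + K%:Z) = count_above X (- K%:Z) (K + K) by lia.
set c := count_above _ _ _ in sE *.
pose b (j : nat) : int := (nth 0%N la j)%:Z - (j.+1)%:Z + s.
pose f (i : nat) : int := - K%:Z + i%:Z.
pose inw := [seq f i | i <- index_iota 0 (K + K) & `[< X (f i) >]].
have bE : perm_eq [seq b j | j <- index_iota 0 c] inw.
  have ub : uniq [seq b j | j <- index_iota 0 c].
    rewrite map_inj_uniq ?iota_uniq // => i j.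
    have [ij|ji|//] := ltngtP i j; rewrite /b.
      by have := @nth_part_le la i j (ltnW ij); lia.
    by have := @nth_part_le la j i (ltnW ji); lia.
  have sub : {subset [seq b j | j <- index_iota 0 c] <= inw}.
    move=> x /mapP[j]; rewrite mem_index_iota => /andP[_ jc] ->.
    have Xb : X (b j) by exists j.
    have lt : b j < K%:Z by rewrite ltNge; apply/negP => /hi; apply.
    have ge : - K%:Z <= b j by rewrite /b; lia.
    have fE : b j = f (absz (b j + K%:Z)) by rewrite /f; lia.
    rewrite fE; apply: map_f; rewrite mem_filter -fE mem_index_iota.
    by apply/andP; split; [exact/asboolP | lia].
  (* With distinct entries on the left, an inclusion and equal sizes suffice. *)
  have sz : (size inw <= size [seq b j | j <- index_iota 0 c])%N.
    rewrite !size_map size_iota subn0 size_filter -sum1_count /c /count_above.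
    by rewrite big_mkcond.
  have [eqm ?] := uniq_min_size ub sub sz.
  apply: uniq_perm => //; rewrite map_inj_uniq ?filter_uniq ?iota_uniq //.
  by move=> i j; rewrite /f; lia.
have -> : moment X K = \sum_(x <- inw) x.
  rewrite big_map big_filter big_mkcond /moment; apply: eq_bigr => i _.
  by rewrite /ind -/(f i); case: asboolP => _; rewrite ?mul1r ?mul0r.
rewrite -(perm_big _ bE) big_map (@part_sizeE la c); last by lia.
by rewrite -big_split /=; apply: eq_bigr => j _; rewrite /b; lia.
Qed.

(** A single window serves for all the components of an [r]-symbol. *)
Lemma rsymbol_moment r (p : multipartition r * multicharge r) :
  exists K0, forall K, (K0 <= K)%N ->
  (forall i, p.2 i + K%:Z =
             \sum_(0 <= j < K + K) ind (rsymbol p i) (- K%:Z + j%:Z)) /\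
  \sum_(i < r) moment (rsymbol p i) K =
    (mpart_size p.1)%:Z + \sum_(i < r) vacuum_moment (p.2 i) K.
Proof.
have /choice[k hk] := fun i => symbol_moment (p.2 i) (p.1 i).
exists (\max_i k i)%N => K hK.
have kK i : (k i <= K)%N by apply: leq_trans hK; exact: leq_bigmax.
split=> [i|]; first by have [] := hk i K (kK i).
rewrite /mpart_size (big_morph Posz PoszD (erefl _)) -big_split /=.
by apply: eq_bigr => i _; have [] := hk i K (kK i).
Qed.

(** Euclidean division by [k] of the integers of the window [[-Mk, Mk)]; the
    quotient is shifted by [M] in order to be indexed by a natural number. *)
Lemma sum_window (M k : nat) (F : int -> int) :
  \sum_(0 <= i < M * k + M * k) F (- (M * k)%:Z + i%:Z) =
  \sum_(0 <= q < M + M) \sum_(j < k) F (j%:Z + k%:Z * (q%:Z - M%:Z)).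
Proof.
rewrite -mulnDl big_nat_mul; apply: eq_bigr => q _.
rewrite -{1}[(q * k)%N]add0n big_addn mulSn addnK big_mkord.
by apply: eq_bigr => j _; congr F; lia.
Qed.

(** The value of [e |la_e| - l |la^l|] for the multicharges [se] and [sl],
    computed with the truncation [M]: the sums with the factors [d] and [c]
    are those of [d] and of [c] over the truncated symbol of [la], and [rev_ord]
    is there because the components of the [l]-symbol are listed by decreasing
    [d]. *)
Definition charge_term e l (se : multicharge e) (sl : multicharge l) M : int :=
  e%:Z * (\sum_(d < l) d%:Z * (sl (rev_ord d) + (M * e)%:Z)
          - \sum_(c < e) vacuum_moment (se c) (M * l))
  - l%:Z * (\sum_(c < e) c%:Z * (se c + (M * l)%:Z)
            - \sum_(k < l) vacuum_moment (sl k) (M * e)).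

(** The two moments and the charges are all rewritten as sums over the triples
    [(q, c, d)], where the identity [e (d + l q) - l (c + e q) = e d - l c] can
    be applied term by term. The truncation is left free above a bound so that
    two partitions can be compared at a common one. *)
Lemma size_balance (e l : nat) (m : int) (la : intpart) pl pe :
  (0 < e)%N -> (0 < l)%N ->
  tau_l m e l la = pl -> tau_e m e la = pe ->
  exists M0, forall M, (M0 <= M)%N ->
    e%:Z * (mpart_size pe.1)%:Z - l%:Z * (mpart_size pl.1)%:Z
    = charge_term pe.2 pl.2 M.
Proof.
move=> e0 l0 /(tau_lP _ _ _ e0 l0)[_ rl] /(tau_eP _ _ _ e0)[_ re].
have [Ke he] := rsymbol_moment pe; have [Kl hl] := rsymbol_moment pl.
exists (Ke + Kl)%N => M hM.
have [{he} ce me] := he (M * l)%N ltac:(nia).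
have [{hl} cl ml] := hl (M * e)%N ltac:(nia).
(* Membership of [c + e d + e l q] in the symbol of [la], with [q] shifted by
   [M]. *)
pose u (c d q : nat) : int :=
  ind (symbol m la) (c%:Z + e%:Z * d%:Z + e%:Z * l%:Z * (q%:Z - M%:Z)).
have eE (c : 'I_e) (d q : nat) :
    ind (rsymbol pe c) (d%:Z + l%:Z * (q%:Z - M%:Z)) = u c d q.
  rewrite re /u /ind /e_components /=.
  by congr (Posz (nat_of_bool `[< symbol _ _ _ >])); ring.
have lE (d : 'I_l) (c : 'I_e) (q : nat) :
    ind (rsymbol pl (rev_ord d)) (c%:Z + e%:Z * (q%:Z - M%:Z)) = u c d q.
  rewrite rl /u /ind rev_ordK; congr (Posz (nat_of_bool _)).
  by apply: asbool_equiv_eq; exact: l_componentsE.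
have ce' (c : 'I_e) :
    pe.2 c + (M * l)%:Z = \sum_(0 <= q < M + M) \sum_(d < l) u c d q.
  rewrite ce (sum_window M l (ind (rsymbol pe c))).
  by apply: eq_bigr => q _; apply: eq_bigr => d _.
have cl' (d : 'I_l) : pl.2 (rev_ord d) + (M * e)%:Z =
    \sum_(0 <= q < M + M) \sum_(c < e) u c d q.
  rewrite cl (sum_window M e (ind (rsymbol pl (rev_ord d)))).
  by apply: eq_bigr => q _; apply: eq_bigr => c _.
have me' : \sum_(c < e) moment (rsymbol pe c) (M * l) =
    \sum_(0 <= q < M + M) \sum_(c < e) \sum_(d < l)
      u c d q * (d%:Z + l%:Z * (q%:Z - M%:Z)).
  rewrite [RHS]exchange_big /=; apply: eq_bigr => c _.
  rewrite /moment (sum_window M l (fun x => ind (rsymbol pe c) x * x)).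
  by apply: eq_bigr => q _; apply: eq_bigr => d _; rewrite eE.
have ml' : \sum_(k < l) moment (rsymbol pl k) (M * e) =
    \sum_(0 <= q < M + M) \sum_(c < e) \sum_(d < l)
      u c d q * (c%:Z + e%:Z * (q%:Z - M%:Z)).
  under [RHS]eq_bigr do rewrite exchange_big.
  rewrite [RHS]exchange_big (reindex_inj rev_ord_inj) /=; apply: eq_bigr => d _.
  rewrite /moment (sum_window M e (fun x => ind (rsymbol pl (rev_ord d)) x * x)).
  by apply: eq_bigr => q _; apply: eq_bigr => c _; rewrite lE.
have de : \sum_(d < l) d%:Z * (pl.2 (rev_ord d) + (M * e)%:Z) =
    \sum_(0 <= q < M + M) \sum_(c < e) \sum_(d < l) u c d q * d%:Z.
  under [RHS]eq_bigr do rewrite exchange_big.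
  rewrite [RHS]exchange_big /=; apply: eq_bigr => d _.
  rewrite cl' mulr_sumr; apply: eq_bigr => q _.
  by rewrite mulr_sumr; apply: eq_bigr => c _; rewrite mulrC.
have dl : \sum_(c < e) c%:Z * (pe.2 c + (M * l)%:Z) =
    \sum_(0 <= q < M + M) \sum_(c < e) \sum_(d < l) u c d q * c%:Z.
  rewrite [RHS]exchange_big /=; apply: eq_bigr => c _.
  rewrite ce' mulr_sumr; apply: eq_bigr => q _.
  by rewrite mulr_sumr; apply: eq_bigr => d _; rewrite mulrC.
have key : e%:Z * \sum_(c < e) moment (rsymbol pe c) (M * l) -
    l%:Z * \sum_(k < l) moment (rsymbol pl k) (M * e) =
    e%:Z * \sum_(d < l) d%:Z * (pl.2 (rev_ord d) + (M * e)%:Z) -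
    l%:Z * \sum_(c < e) c%:Z * (pe.2 c + (M * l)%:Z).
  rewrite me' ml' de dl !mulr_sumr -!sumrB; apply: eq_bigr => q _.
  rewrite !mulr_sumr -!sumrB; apply: eq_bigr => c _.
  rewrite !mulr_sumr -!sumrB; apply: eq_bigr => d _; ring.
rewrite /charge_term; move: key; rewrite me ml.
set Ve := \sum_(c < e) vacuum_moment _ _.
set Vl := \sum_(k < l) vacuum_moment _ _.
set D := \sum_(d < l) _; set C := \sum_(c < e) _ => key.
by move: key; clearbody Ve Vl D C; lia.
Qed.

Theorem proposition3p4 (e l : nat) (m : int) (he : (2 <= e)%N) (hl : (1 <= l)%N)
  (la mu : intpart)
  (la_l mu_l : multipartition l) (s_l : multicharge l)
  (la_e mu_e : multipartition e) (s_e : multicharge e) :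
  tau_l m e l la = (la_l, s_l) ->
  tau_e m e la = (la_e, s_e) ->
  tau_l m e l mu = (mu_l, s_l) ->
  tau_e m e mu = (mu_e, s_e) ->
  mpart_size mu_l = mpart_size la_l ->
  mpart_size mu_e = mpart_size la_e.
Proof.
have e0 : (0 < e)%N by apply: ltnW.
move=> lal lae mul mue sz.
have [M1 Hla] := size_balance e0 hl lal lae.
have [M2 Hmu] := size_balance e0 hl mul mue.
have := Hla (M1 + M2)%N (leq_addr _ _).
rewrite -{Hmu}(Hmu (M1 + M2)%N (leq_addl _ _)) /= sz.
move/addIr/mulfI => inj; suff [] : (mpart_size la_e)%:Z = mpart_size mu_e by [].
by apply: inj; lia.
Qed.
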